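(* Consider the finite horizon discounted expected cost transmission scheduling problem with a single receiver, piecewise-linear convex power-rate curves, i.i.d. channel conditions, linear holding costs, and with power-rate breakpoints and maximal transmission quantities that are integer multiples of $d$, as described in the context. For $s\in\mathcal{S}$ let $p(s)$ be the probability that the channel is in state $s$ in a time slot, let $\tilde L_k(s):=\frac{\tilde z_k(s)}{d}$ for $k\in\{-1,0,1,\ldots,K-1\}$ (so $\tilde L_{-1}(s)=0$), and let $\tilde L_{\max}(s):=\frac{\tilde z_{\max}(s)}{d}$. Define the thresholds $\tilde\gamma_{n,j}$ for $n\in\{1,2,\ldots,N\}$ and $j\in\mathbb{N}$ recursively as follows: (i) if $j=1$, $\tilde\gamma_{n,j}=\infty$; (ii) if $j>n$, $\tilde\gamma_{n,j}=0$; (iii) if $2\le j\le n$, $$\begin{aligned}\tilde\gamma_{n,j}=-h+\alpha\cdot\Biggl(&\sum_{s:\,\tilde c_0(s)\ge\tilde\gamma_{n-1,j-1}}p(s)\,\tilde\gamma_{n-1,j-1}\\&+\sum_{k=0}^{K-1}\Biggl\{\sum_{s:\,\tilde\gamma_{n-1,j-1+\tilde L_k(s)}\le\tilde c_k(s)<\tilde\gamma_{n-1,j-1+\tilde L_{k-1}(s)}}p(s)\,\tilde c_k(s)+\sum_{s:\,\tilde c_k(s)<\tilde\gamma_{n-1,j-1+\tilde L_k(s)}\le\tilde c_{k+1}(s)}p(s)\,\tilde\gamma_{n-1,j-1+\tilde L_k(s)}\Biggr\}\\&+\sum_{s:\,\tilde\gamma_{n-1,j-1+\tilde L_{\max}(s)}\le\tilde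 c_K(s)<\tilde\gamma_{n-1,j-1+\tilde L_{K-1}(s)}}p(s)\,\tilde c_K(s)\\&+\sum_{s:\,\tilde c_K(s)<\tilde\gamma_{n-1,j-1+\tilde L_{\max}(s)}}p(s)\,\tilde\gamma_{n-1,j-1+\tilde L_{\max}(s)}\Biggr).\end{aligned}$$ For each $n\in\{1,2,\ldots,N\}$ and $s\in\mathcal{S}$, define $b_{n,-1}(s):=\infty$ and, for all $k\in\{0,1,\ldots,K\}$, if $\tilde\gamma_{n,j+1}\le\tilde c_k(s)<\tilde\gamma_{n,j}$, define $b_{n,k}(s):=j\cdot d$. Then the optimal control strategy is given by $\boldsymbol{\pi}^*=\{z_N^*,z_{N-1}^*,\ldots,z_1^*\}$, where for all $n\in\{N,N-1,\ldots,1\}$ the number of packets transmitted in slot $n$ in state $(x,s)$ is $$z_n^*(x,s):=\begin{cases}\tilde z_{k-1}(s),&\text{if }b_{n,k}(s)-\tilde z_{k-1}(s)<x\le b_{n,k-1}(s)-\tilde z_{k-1}(s),\ k\in\{0,1,\ldots,K\},\\ b_{n,k}(s)-x,&\text{if }b_{n,k}(s)-\tilde z_k(s)<x\le b_{n,k}(s)-\tilde z_{k-1}(s),\ k\in\{0,1,\ldots,K-1\},\\ b_{n,K}(s)-x,&\text{if }b_{n,K}(s)-\tilde z_{\max}(s)<x\le b_{n,K}(s)-\tilde z_{K-1}(s),\\ \tilde z_{\max}(s),&\text{if }0\le x\le b_{n,K}(s)-\tilde z_{\max}(s).\end{cases}$$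
   Context: Time is discrete and indexed backwards: $n=N,N-1,\ldots,1$ is the number of slots remaining in a horizon of length $N\in\mathbb{N}$. The channel conditions $S_N,\ldots,S_1$ are independent and identically distributed on a finite set $\mathcal{S}$, and unaffected by scheduling decisions. $P>0$ is the power available per slot and $d>0$ is the number of packets removed from the receiver buffer at the end of each slot. Transmitting $z\ge0$ packets (a real number) under channel condition $s$ consumes power $$c(z,s)=z\,\tilde c_0(s)+\sum_{k=0}^{K-1}\bigl(\tilde c_{k+1}(s)-\tilde c_k(s)\bigr)\max\{z-\tilde z_k(s),0\},$$ where $0<\tilde c_0(s)\le\tilde c_1(s)\le\cdots\le\tilde c_K(s)$ and $0=\tilde z_{-1}(s)<\tilde z_0(s)<\cdots<\tilde z_{K-1}(s)<\tilde z_K(s)=\infty$. Let $\tilde z_{\max}(s)$ be the unique $z$ with $c(z,s)=P$; it is assumed that $\tilde z_{\max}(s)\ge d$ and $\tilde z_{\max}(s)>\tilde z_{K-1}(s)$ for all $s\in\mathcal{S}$. For each $s\in\mathcal{S}$, $\tilde z_{\max}(s)$ and each of $\tilde z_0(s),\ldots,\tilde z_{K-1}(s)$ is a positive integer multiple of $d$. The holding cost function is linear: $h(x)=h\cdot x$ with constant $h\ge0$. The discount factor is $\alpha\in[0,1]$. At the beginning of slot $n$ the scheduler observes the buffer level $X_n=x\ge0$ and channel condition $S_n=s$ and chooses the number $Z_n=z$ of packets to transmit subject to $\max(0,d-x)\le z\le\tilde z_{\max}(s)$ (no underflow; power constraint). Then $X_{n-1}=X_n+Z_n-d$. The buffer is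 empty at the beginning of the horizon: $X_N=0$. The problem is to minimize $\mathbb{E}\bigl[\sum_{t=1}^N\alpha^{N-t}\{c(Z_t,S_t)+h\cdot(X_t+Z_t-d)\}\bigr]$ over all history-dependent randomized and deterministic policies. *)

(* Defs.v *)
From mathcomp Require Import all_boot all_order all_algebra archimedean.
From mathcomp Require Import boolp classical_sets reals ereal measure.
From mathcomp Require Import measurable_realfun lebesgue_measure.
From mathcomp Require Import lebesgue_integral kernel.

Set Implicit Arguments.
Unset Strict Implicit.
Unset Printing Implicit Defensive.

Import Order.TTheory GRing.Theory Num.Theory.

Local Open Scope classical_set_scope.
Local Open Scope ring_scope.
Local Open Scope ereal_scope.

(* Packet quantities are real.  [slope k] is c~_k for 0 <= k <= K and [brk k] is
   z~_k for 0 <= k <= K - 1; larger indices are irrelevant. *)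
Record model (R : realType) (S : finType) := Model {
  horizon : nat;           (* N *)
  nbrk : nat;              (* K *)
  prob : S -> R;           (* p(s) *)
  power : R;               (* P *)
  drain : R;               (* d *)
  slope : nat -> S -> R;   (* c~_k(s) *)
  brk : nat -> S -> R;     (* z~_k(s) *)
  zmax : S -> R;           (* z~_max(s) *)
  hold : R;                (* h *)
  disc : R                 (* alpha *)
}.

Section Model.
Context {R : realType} {S : finType} (M : model R S).

Local Notation N := (horizon M).
Local Notation K := (nbrk M).
Local Notation p := (prob M).
Local Notation d := (drain M).
Local Notation ct := (slope M).
Local Notation zt := (brk M).
Local Notation zM := (zmax M).
Local Notation h := (hold M).
Local Notation alpha := (disc M).

(* z~_{k-1}(s), with z~_{-1}(s) = 0 *)
Definition brkp (k : nat) (s : S) : R := if k is k'.+1 then zt k' s else 0%R.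

Definition txpower (z : R) (s : S) : R :=
  (z * ct 0 s
   + \sum_(k < K) (ct k.+1 s - ct k s) * Num.max (z - zt k s) 0)%R.

(* Since slopes are positive, txpower ^~ s is strictly increasing, so
   [zmax_eq] determines zmax. *)
Record standing_assumptions : Prop := StandingAssumptions {
  horizon_gt0 : (0 < N)%N;
  prob_ge0 : forall s, (0 <= p s)%R;
  prob_sum1 : (\sum_s p s = 1)%R;
  power_gt0 : (0 < power M)%R;
  drain_gt0 : (0 < d)%R;
  slope0_gt0 : forall s, (0 < ct 0 s)%R;
  slope_le : forall s k, (k < K)%N -> (ct k s <= ct k.+1 s)%R;
  brk_lt : forall s k, (k < K)%N -> (brkp k s < zt k s)%R;
  zmax_eq : forall s, txpower (zM s) s = power M;
  zmax_ge_drain : forall s, (d <= zM s)%R;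
  zmax_gt_brk : forall s, (brkp K s < zM s)%R;
  brk_mult : forall s k, (k < K)%N ->
    exists2 m : nat, (0 < m)%N & zt k s = (m%:R * d)%R;
  zmax_mult : forall s, exists2 m : nat, (0 < m)%N & zM s = (m%:R * d)%R;
  hold_ge0 : (0 <= h)%R;
  disc_itv : (0 <= alpha <= 1)%R
}.

(* A history after t slots is a pair of t-tuples: the observed channel
   conditions sigma and the transmitted quantities zeta, in chronological order;
   then n = N - t slots remain. *)

(* Buffer level reached from the empty buffer: X_{n-1} = X_n + Z_n - d. *)
Definition buffer (zeta : seq R) : R := foldl (fun x z => x + z - d)%R 0%R zeta.

Definition actions (x : R) (s : S) : set R :=
  [set z | (Num.max 0 (d - x) <= z <= zM s)%R].

Definition feasible_history (t : nat) (sigma : t.-tuple S)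
    (zeta : t.-tuple R) : Prop :=
  forall i : 'I_t,
    actions (buffer (take i zeta)) (tnth sigma i) (tnth zeta i).

(* History-dependent randomized decision rules; the deterministic ones are those
   whose values are Dirac measures.  As S is finite, measurability in the
   channel conditions is automatic. *)
Definition policy : Type :=
  forall t : nat, t.-tuple S -> S ->
    R.-pker (t.-tuple (measurableTypeR R)) ~> (measurableTypeR R).

Definition admissible (pi : policy) : Prop :=
  forall (t : nat) (sigma : t.-tuple S) (s : S) (zeta : t.-tuple R),
    (t < N)%N -> feasible_history sigma zeta ->
    pi t sigma s zeta (actions (buffer zeta) s) = 1.

(* The conditional expectation of F(S_N, ..., S_{n-m+1}, Z_N, ..., Z_{n-m+1})
   given a history of length t = N - n, i.e. the integral of F against the
   Ionescu-Tulcea law of the next m slots: in each slot the channel condition is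
   drawn from p independently of the history, then the transmitted quantity is
   drawn from the policy. *)
Fixpoint expectation (pi : policy)
    (F : forall t : nat, t.-tuple S -> t.-tuple R -> R)
    (m t : nat) (sigma : t.-tuple S) (zeta : t.-tuple R) : \bar R :=
  if m is m'.+1 then
    \sum_(s : S) (p s)%:E *
      \int[pi t sigma s zeta]_z
        expectation pi F m' [tuple of rcons sigma s] [tuple of rcons zeta z]
  else (F t sigma zeta)%:E.

(* With n slots remaining in slot i (counted from 0), the discount is
   alpha ^ (N - n) = alpha ^ i. *)
Definition total_cost (t : nat) (sigma : t.-tuple S) (zeta : t.-tuple R) : R :=
  (\sum_(i < t) alpha ^+ i *
     (txpower (tnth zeta i) (tnth sigma i)
      + h * (buffer (take i zeta) + tnth zeta i - d)))%R.

Definition expected_cost (pi : policy) : \bar R :=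
  expectation pi total_cost N [tuple] [tuple].

Definition optimal (pi : policy) : Prop :=
  admissible pi /\
  forall pi', admissible pi' -> expected_cost pi <= expected_cost pi'.

(* x / d as a natural number; exact when x is a nonnegative integer multiple of
   d, as are all z~_k and z~_max. *)
Definition units (x : R) : nat := Num.truncn (x / d).

Definition Lbrk (k : nat) (s : S) : nat := units (zt k s).
Definition Lbrkp (k : nat) (s : S) : nat := units (brkp k s).
Definition Lmax (s : S) : nat := units (zM s).

(* Meaningful for n >= 1 and j >= 1; other values are never used. *)
Fixpoint gamma (n j : nat) {struct n} : \bar R :=
  if j == 1%N then +oo
  else if (n < j)%N then 0
  else if n is n'.+1 then
    let g l := gamma n' (j.-1 + l)%N in
    - h%:E + alpha%:E *
      (\sum_(s | g 0%N <= (ct 0 s)%:E) (p s)%:E * g 0%N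
       + \sum_(k < K)
           (\sum_(s | g (Lbrk k s) <= (ct k s)%:E < g (Lbrkp k s))
               (p s)%:E * (ct k s)%:E
            + \sum_(s | (ct k s)%:E < g (Lbrk k s) <= (ct k.+1 s)%:E)
               (p s)%:E * g (Lbrk k s))
       + \sum_(s | g (Lmax s) <= (ct K s)%:E < g (Lbrkp K s))
           (p s)%:E * (ct K s)%:E
       + \sum_(s | (ct K s)%:E < g (Lmax s)) (p s)%:E * g (Lmax s))
  else 0.

Definition critical_index (n k : nat) (s : S) (j : nat) : Prop :=
  (1 <= j)%N /\ gamma n j.+1 <= (ct k s)%:E < gamma n j.

(* b_{n,k}(s) for k >= 0 *)
Definition critical (n k : nat) (s : S) : R :=
  ((xget 0%N [set j | critical_index n k s j])%:R * d)%R.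

(* b_{n,k-1}(s), with b_{n,-1}(s) = +oo *)
Definition criticalp (n k : nat) (s : S) : \bar R :=
  if k is k'.+1 then (critical n k' s)%:E else +oo.

(* zstar_case n x s z: z is the value at (x, s) of one of the four branches
   defining z_n^*, whose condition holds. *)
Inductive zstar_case (n : nat) (x : R) (s : S) : R -> Prop :=
| ZstarBrk (k : nat) of (k <= K)%N &
    (critical n k s - brkp k s < x)%R &
    x%:E <= criticalp n k s - (brkp k s)%:E :
    zstar_case n x s (brkp k s)
| ZstarFill (k : nat) of (k < K)%N &
    (critical n k s - zt k s < x <= critical n k s - brkp k s)%R :
    zstar_case n x s (critical n k s - x)%R
| ZstarFillMax of
    (critical n K s - zM s < x <= critical n K s - brkp K s)%R :
    zstar_case n x s (critical n K s - x)%R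
| ZstarMax of (0 <= x <= critical n K s - zM s)%R :
    zstar_case n x s (zM s).

Definition zstar (n : nat) (x : R) (s : S) : R := xget 0%R (zstar_case n x s).

(* Only feasible histories matter, so pi may be arbitrary elsewhere. *)
Definition is_markov_policy (pi : policy) (z : nat -> R -> S -> R) : Prop :=
  forall (t : nat) (sigma : t.-tuple S) (s : S) (zeta : t.-tuple R)
         (A : set R),
    (t < N)%N -> feasible_history sigma zeta ->
    measurable (A : set (measurableTypeR R)) ->
    pi t sigma s zeta A = \d_(z (N - t)%N (buffer zeta) s) A.

End Model.

(* Main.v *)
Require Import Defs.
From mathcomp Require Import all_boot all_order all_algebra.
From mathcomp Require Import ring lra zify.
From mathcomp Require Import boolp classical_sets functions reals ereal measure.
From mathcomp Require Import measurable_realfun lebesgue_measure numfun.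
From mathcomp Require Import lebesgue_integral kernel.

(* Let [Q] be the optimal cost of the remaining slots as a function of the
   buffer level after transmission.  By induction on the number [n] of slots,
   [Q] is convex and has slope [- gamma n j] on the [j]-th interval of length
   [d], [2 <= j <= n]; this is stated as the support inequality
     [Q y - gamma n j * (y' - y) <= Q y'],
   which needs no derivatives.  For [x] in the [i]-th interval the control [z]
   of the theorem admits a [lam], independent of [x], that is a subgradient of
   the power curve at [z] while [- lam] is one of [Q] at [x + z].  Adding the
   two support inequalities shows both that [z] is optimal and that [- lam]
   supports the cost with one more slot; averaging [lam] over the channel gives
   the recursion for [gamma n.+1 i.+1].  Backward induction then bounds the cost
   of an arbitrary randomized history-dependent policy. *)

Set Implicit Arguments.
Unset Strict Implicit.
Unset Printing Implicit Defensive.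

Import Order.TTheory GRing.Theory Num.Theory.

Local Open Scope ring_scope.

(** * Integrals against a probability measure concentrated on a set *)

(* Measurability of [f] is nowhere assumed below: the cost-to-go of an arbitrary
   history-dependent policy is integrated without proving it measurable. *)
Section IntegralConcentrated.
Context d (T : measurableType d) (R : realType).
Variable mu : {measure set T -> \bar R}.
Variables (A : set T) (mA : measurable A).
Hypotheses (muT : mu setT = 1%E) (mu1 : mu A = 1%E).
Local Open Scope classical_set_scope.
Import HBNNSimple.
Implicit Types (f : T -> \bar R) (C : R).
Local Open Scope ereal_scope.

Let mu0 : mu (~` A) = 0.
Proof.
have e : 1 = 1 + mu (~` A).
  rewrite -[LHS]muT -{1}mu1 -(setUv A) measureU//; first exact: measurableC.
  by rewrite setICr.
have fin : mu (~` A) \is a fin_num.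
  rewrite ge0_fin_numE// (@le_lt_trans _ _ 1)// ?ltry// -muT.
  by rewrite le_measure// ?inE//; exact: measurableC.
by move: e; rewrite -(fineK fin) => -[e]; congr EFin; lra.
Qed.

(** The simple function equal to [C] on [A] and to 0 elsewhere lies below [f] and has integral [C],
    as [mu A = 1]. *)
Lemma ge0_integral_ge f C : (0 <= C)%R -> (forall x, 0 <= f x) ->
  (forall x, A x -> C%:E <= f x) -> C%:E <= \int[mu]_x f x.
Proof.
move=> C0 f0 fC; rewrite ge0_integralTE//.
pose h : {nnsfun T >-> R} :=
  mul_nnsfun (cst_nnsfun T (NngNum C0)) (indic_nnsfun R mA).
have <- : sintegral mu h = C%:E.
  transitivity (sintegral mu (cst C \* indic_nnsfun R mA)%R).
    by apply: eq_sintegral.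
  by rewrite sintegralrM sintegral_indic// mu1 mule1.
apply: ereal_sup_ubound; exists h => // x.
change ((C * (x \in A)%:R)%:E <= f x).
case: (boolP (x \in A)) => [/set_mem/fC|_]; rewrite ?mulr1 ?mulr0 //.
Qed.

(** A simple function below [f] is measurable even when [f] is not; the complement of [A] is null,
    and on [A] it is at most [C]. *)
Lemma ge0_integral_le f C : (forall x, 0 <= f x) ->
  (forall x, A x -> f x <= C%:E) -> \int[mu]_x f x <= C%:E.
Proof.
move=> f0 fC; rewrite ge0_integralTE//.
apply: ge_ereal_sup => _ [g /= gf <-].
rewrite -integralT_nnsfun (ge0_negligible_integral (measurableC mA))//; last 2 first.
  - exact/measurable_EFinP.
  - by move=> x _; rewrite lee_fin.
rewrite setTD setCK.
have -> : C%:E = \int[mu]_(x in A) C%:E by rewrite integral_cst// mu1 mule1.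
apply: ge0_le_integral => //.
- by move=> x _; rewrite lee_fin.
- by apply/measurable_EFinP; exact: measurable_funTS.
- by move=> x Ax; exact: le_trans (gf x) (fC x Ax).
Qed.

(** Since [C] is nonnegative, the negative part of [f] vanishes on [A] and integrates to 0. *)
Lemma integral_ge_concentrated f C : (0 <= C)%R ->
  (forall x, A x -> C%:E <= f x) -> C%:E <= \int[mu]_x f x.
Proof.
move=> C0 fC; rewrite integralE.
have -> : \int[mu]_x f^\- x = 0.
  apply/eqP; rewrite eq_le; apply/andP; split; last exact: integral_ge0.
  apply: (@ge0_integral_le _ 0%R) => // x Ax.
  by rewrite funenegE ge_max leeNl oppe0 lexx (le_trans _ (fC x Ax)) ?lee_fin.
rewrite sube0; apply: ge0_integral_ge => // x Ax.
by rewrite funeposE le_max fC.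
Qed.

Lemma integral_eq_concentrated f C : (0 <= C)%R ->
  (forall x, A x -> f x = C%:E) -> \int[mu]_x f x = C%:E.
Proof.
move=> C0 fC; apply/eqP; rewrite eq_le integral_ge_concentrated// ?andbT; last first.
  by move=> x /fC ->.
rewrite integralE.
have fp : \int[mu]_x f^\+ x <= C%:E.
  by apply: ge0_integral_le => // x Ax; rewrite funeposE fC// ge_max lexx lee_fin.
apply: le_trans fp; rewrite geeDl// oppe_le0 integral_ge0//.
Qed.
End IntegralConcentrated.

(** * The piecewise-linear power curve *)

Section Segments.
Context {R : realType} {S : finType} (M : model R S).
Hypothesis SA : standing_assumptions M.

Local Notation K := (nbrk M).
Local Notation d := (drain M).
Local Notation ct := (slope M).
Local Notation zt := (brk M).
Local Notation zM := (zmax M).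

(* The [k]-th linear piece of [txpower] is [[seg k, seg k.+1]], [k <= K]. *)
Definition seg (k : nat) (s : S) : R :=
  if k == K.+1 then zM s else brkp M k s.

Definition segL (k : nat) (s : S) : nat := units M (seg k s).

Lemma seg0 s : seg 0 s = 0. Proof. by []. Qed.

Lemma segS k s : (k < K)%N -> seg k.+1 s = zt k s.
Proof. by rewrite /seg eqSS => kK; rewrite ltn_eqF. Qed.

Lemma seg_brkp k s : (k <= K)%N -> seg k s = brkp M k s.
Proof. by rewrite /seg => kK; rewrite ltn_eqF. Qed.

Lemma seg_max s : seg K.+1 s = zM s.
Proof. by rewrite /seg eqxx. Qed.

Lemma seg_ltS k s : (k <= K)%N -> seg k s < seg k.+1 s.
Proof.
move=> kK; rewrite seg_brkp//; move: kK; rewrite leq_eqVlt => /predU1P[->|kK].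
  by rewrite seg_max; exact: zmax_gt_brk.
by rewrite segS//; exact: brk_lt.
Qed.

(** The truncation in [units] loses nothing, as breakpoints and [zM s] are integer multiples of
    [d]. *)
Lemma seg_mult k s : (k <= K.+1)%N -> seg k s = (segL k s)%:R * d.
Proof.
move=> kK; suff [m e] : exists m : nat, seg k s = m%:R * d.
  by rewrite /segL /units e mulfK ?natrK// gt_eqF// drain_gt0.
move: kK; rewrite leq_eqVlt => /predU1P[->|].
  by rewrite seg_max; have [m _ ->] := zmax_mult SA s; exists m.
case: k => [|k] kK; first by exists 0%N; rewrite mul0r.
by rewrite segS//; have [m _ ->] := brk_mult SA s kK; exists m.
Qed.

Lemma segL0 s : segL 0 s = 0%N.
Proof. by rewrite /segL /units seg0 mul0r truncn0. Qed.

Lemma segL_ltS k s : (k <= K)%N -> (segL k s < segL k.+1 s)%N.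
Proof.
move=> kK; have := seg_ltS s kK; rewrite !seg_mult//; last exact: leqW.
by rewrite ltr_pM2r ?drain_gt0// ltr_nat.
Qed.

Lemma segL_le k l s : (k <= l)%N -> (l <= K.+1)%N -> (segL k s <= segL l s)%N.
Proof.
move=> + lK; elim: l lK => [|l IH] lK; first by rewrite leqn0 => /eqP ->.
rewrite leq_eqVlt => /predU1P[->//|kl].
exact: leq_trans (IH (ltnW lK) kl) (ltnW (segL_ltS _ lK)).
Qed.

Lemma seg_le k l s : (k <= l)%N -> (l <= K.+1)%N -> seg k s <= seg l s.
Proof.
move=> kl lK; rewrite !seg_mult ?(leq_trans kl)//.
by rewrite ler_pM2r ?drain_gt0// ler_nat segL_le.
Qed.

Lemma slope_gt0 k s : (k <= K)%N -> 0 < ct k s.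
Proof.
elim: k => [|k IH] kK; first exact: slope0_gt0.
exact: lt_le_trans (IH (ltnW kK)) (slope_le SA s kK).
Qed.

Lemma slope_homo k l s : (k <= l)%N -> (l <= K)%N -> ct k s <= ct l s.
Proof.
move=> + lK; elim: l lK => [|l IH] lK; first by rewrite leqn0 => /eqP ->.
rewrite leq_eqVlt => /predU1P[->//|kl].
exact: le_trans (IH (ltnW lK) kl) (slope_le SA s lK).
Qed.

Lemma txpower_ge0 z s : 0 <= z -> 0 <= txpower M z s.
Proof.
move=> z0; rewrite addr_ge0//; first by rewrite mulr_ge0// ltW// slope_gt0.
apply: sumr_ge0 => k _; rewrite mulr_ge0//; last by rewrite le_max lexx orbT.
by rewrite subr_ge0; exact: slope_le.
Qed.

(** Convexity: [ct k] is a subgradient on the whole closed [k]-th piece, so a breakpoint admits both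
    adjacent slopes. Writing [ct k] as a telescoping sum reduces the claim to one kink at a time. *)
Lemma txpower_support k z z' s : (k <= K)%N -> seg k s <= z <= seg k.+1 s ->
  txpower M z s + ct k s * (z' - z) <= txpower M z' s.
Proof.
move=> kK /andP[kz zk].
have ctE : ct k s = ct 0 s + \sum_(l < K) (ct l.+1 s - ct l s) * (l < k)%N%:R.
  rewrite (bigID (fun l : 'I_K => (l < k)%N))/=.
  rewrite [X in _ + (_ + X)]big1 ?addr0; last first.
    by move=> l /negbTE ->; rewrite mulr0.
  under eq_bigr do rewrite mulrC.
  under eq_bigr => l lk do rewrite lk mul1r.
  rewrite (big_ord_narrow kK)/=.
  rewrite -(big_mkord xpredT (fun l => ct l.+1 s - ct l s)).
  by rewrite telescope_sumr//; ring.
rewrite /txpower ctE mulrDl mulr_suml addrACA.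
rewrite [X in X + _](_ : _ = z' * ct 0 s); last by ring.
rewrite lerD2l -big_split/=; apply: ler_sum => l _.
rewrite -mulrA -mulrDr ler_wpM2l ?subr_ge0 ?slope_le//.
have [lk|kl] := ltnP l k; rewrite /= ?mul1r ?mul0r ?addr0.
  have : zt l s <= z by rewrite -segS//; apply: le_trans kz; apply: seg_le; lia.
  by move=> ?; rewrite (max_idPl _) ?subr_ge0// le_max; apply/orP; left; lra.
have : z <= zt l s.
  by rewrite -segS//; apply: (le_trans zk); apply: seg_le => //; rewrite ltnS ltnW.
by move=> ?; rewrite (max_idPr _) ?subr_le0// le_max lexx orbT.
Qed.

End Segments.

(** * Thresholds and critical levels *)

Section Thresholds.
Local Open Scope classical_set_scope.
Context {R : realType} {S : finType} (M : model R S).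
Hypothesis SA : standing_assumptions M.

Local Notation K := (nbrk M).
Local Notation d := (drain M).
Local Notation ct := (slope M).
Local Notation gamma := (gamma M).

Lemma gamma1 n : gamma n 1 = +oo%E.
Proof. by case: n. Qed.

Lemma gamma_gt n j : (1 < j)%N -> (n < j)%N -> gamma n j = 0%E.
Proof. by case: n => [|n] /= j1 nj; rewrite gtn_eqF// nj. Qed.

(* Past [n * d] the recursion sets [gamma n] to 0 although the slope of [Q] may
   be positive there; only the sign of that slope matters. *)
Definition gamma_supports (n : nat) (Q : R -> R) : Prop :=
  [/\ forall j, (2 <= j)%N -> gamma n j \is a fin_num,
      forall j y y', (2 <= j <= n)%N -> j.-1%:R * d <= y <= j%:R * d ->
        d <= y' -> Q y - fine (gamma n j) * (y' - y) <= Q y'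
    & forall y, n%:R * d <= y -> exists2 mu, mu <= 0 &
        forall y', d <= y' -> Q y - mu * (y' - y) <= Q y'].

Variables (n : nat) (Q : R -> R).
Hypotheses (n_gt0 : (0 < n)%N) (HQ : gamma_supports n Q).

Lemma lt_gamma_index c j : 0 <= c -> (1 <= j)%N ->
  (c%:E < gamma n j)%E -> (j <= n)%N.
Proof.
move=> c0; case: j => [//|[//|j]] _; rewrite leqNgt; apply: contraL => nj.
by rewrite gamma_gt// lte_fin -leNgt.
Qed.

(** Plain monotonicity can fail, since thresholds up to index [n] may be negative and later ones are
    set to 0. Exceeding [c >= 0] forces [j' <= n]; then the two support inequalities between
    [j.-1 * d] and [j' * d], one in each direction, are added. *)
Lemma gamma_anti c j j' : 0 <= c -> (1 <= j <= j')%N ->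
  (c%:E < gamma n j')%E -> (c%:E < gamma n j)%E.
Proof.
move=> c0 /andP[j1 jj'] cj'.
move: j1; rewrite leq_eqVlt => /predU1P[<-|j2]; first by rewrite gamma1 ltry.
move: jj'; rewrite leq_eqVlt => /predU1P[->//|jj'].
have j'n : (j' <= n)%N by apply: lt_gamma_index cj' => //; lia.
have [fin sup _] := HQ.
apply: (lt_le_trans cj').
rewrite -(fineK (fin j j2)) -(fineK (fin j' _)); last by lia.
rewrite lee_fin.
have d0 := drain_gt0 SA.
have h1 : d <= j.-1%:R * d by rewrite -[X in X <= _]mul1r ler_pM2r// ler1n; lia.
have h2 : j.-1%:R * d <= j%:R * d by rewrite ler_pM2r// ler_nat; lia.
have h3 : j%:R * d <= j'.-1%:R * d by rewrite ler_pM2r// ler_nat; lia.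
have h4 : j'.-1%:R * d < j'%:R * d by rewrite ltr_pM2r// ltr_nat; lia.
have s1 : Q (j'%:R * d) - fine (gamma n j') * (j.-1%:R * d - j'%:R * d)
    <= Q (j.-1%:R * d).
  by apply: sup => //; [lia|rewrite lexx andbT ltW].
have s2 : Q (j.-1%:R * d) - fine (gamma n j) * (j'%:R * d - j.-1%:R * d)
    <= Q (j'%:R * d).
  apply: sup => //; [lia|by rewrite lexx h2|].
  by rewrite (le_trans h1)// (le_trans h2)// (le_trans h3)// ltW.
have ab : 0 < j'%:R * d - j.-1%:R * d.
  by rewrite subr_gt0; apply: le_lt_trans h4; exact: le_trans h3.
rewrite -(ler_pM2r ab).
clear -s1 s2; move: s1 s2.
move: (j.-1%:R * d) (j'%:R * d) (fine (gamma n j)) (fine (gamma n j')) => a b c e.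
lra.
Qed.

Lemma critical_index_uniq k s j j' : (k <= K)%N ->
  critical_index M n k s j -> critical_index M n k s j' -> j = j'.
Proof.
move=> kK [j1 /andP[jl ju]] [j1' /andP[jl' ju']].
have c0 := ltW (slope_gt0 SA s kK).
have aux i i' : (1 <= i')%N -> (gamma n i.+1 <= (ct k s)%:E)%E ->
    ((ct k s)%:E < gamma n i')%E -> (i' <= i)%N.
  move=> i1 h1 h2; rewrite leqNgt; apply/negP => ii'.
  have := @gamma_anti (ct k s) i.+1 i' c0; rewrite ii' => /(_ isT h2).
  by rewrite ltNge h1.
by apply/eqP; rewrite eqn_leq; apply/andP; split; exact: aux.
Qed.

(** The largest [j] whose threshold exceeds the slope works: 1 qualifies as [gamma n 1] is infinite,
    and no index beyond [n] does. *)
Lemma critical_index_exists k s : (k <= K)%N ->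
  exists j, critical_index M n k s j.
Proof.
move=> kK; have c0 := ltW (slope_gt0 SA s kK).
pose P j := (1 <= j)%N && ((ct k s)%:E < gamma n j)%E.
have exP : exists j, P j by exists 1%N; rewrite /P gamma1 ltry.
have ubP j : P j -> (j <= n)%N by move=> /andP[]; exact: lt_gamma_index.
case: (ex_maxnP exP ubP) => j /andP[j1 Pj] jmax; exists j; split => //.
rewrite Pj andbT leNgt; apply/negP => h.
by have := jmax j.+1; rewrite /P h ltnn => /(_ isT).
Qed.

(** The number [b_{m,k}(s) / d]; through it, comparisons of slopes with thresholds become arithmetic
    on [nat]. *)
Definition level (m k : nat) (s : S) : nat :=
  xget 0%N [set j | critical_index M m k s j].

Lemma criticalE m k s : critical M m k s = (level m k s)%:R * d.
Proof. by []. Qed.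

Lemma levelP k s : (k <= K)%N -> critical_index M n k s (level n k s).
Proof.
move=> kK; have [j jP] := critical_index_exists s kK.
exact: (@xgetI _ _ _ j).
Qed.

Lemma level_gt0 k s : (k <= K)%N -> (0 < level n k s)%N.
Proof. by move=> kK; case: (levelP s kK). Qed.

Lemma lt_gammaE k s j : (k <= K)%N -> (1 <= j)%N ->
  ((ct k s)%:E < gamma n j)%E = (j <= level n k s)%N.
Proof.
move=> kK j1; have [l1 /andP[ll lu]] := levelP s kK.
have c0 := ltW (slope_gt0 SA s kK).
apply/idP/idP => h; last by apply: gamma_anti lu => //; rewrite j1.
rewrite leqNgt; apply/negP => jl.
have := @gamma_anti (ct k s) (level n k s).+1 j c0; rewrite jl => /(_ isT h).
by rewrite ltNge ll.
Qed.

Lemma ge_gammaE k s j : (k <= K)%N -> (1 <= j)%N ->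
  (gamma n j <= (ct k s)%:E)%E = (level n k s < j)%N.
Proof. by move=> kK j1; rewrite leNgt lt_gammaE// ltnNge. Qed.

Lemma level_anti k l s : (k <= l)%N -> (l <= K)%N ->
  (level n l s <= level n k s)%N.
Proof.
move=> kl lK; rewrite -lt_gammaE ?level_gt0 ?(leq_trans kl)//.
have [_ /andP[_]] := levelP s lK; apply: le_lt_trans.
by rewrite lee_fin; exact: slope_homo.
Qed.

(* For [x] in [[i.-1 * d, i * d]], the place where the marginal values
   [gamma n (i + l)] of the [l]-th extra unit [d] fall below its marginal cost:
   at a breakpoint, inside a piece, or not before [zmax]. *)
Variant cell (i : nat) (s : S) : Prop :=
| CellBrk m of (m <= K)%N & (level n m s < i + segL M m s)%N &
    ((0 < m)%N -> (i + segL M m s <= level n m.-1 s)%N)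
| CellFill m of (m <= K)%N &
    (i + segL M m s <= level n m s < i + segL M m.+1 s)%N
| CellMax of (i + segL M K.+1 s <= level n K s)%N.

Lemma cellP i s : cell i s.
Proof.
clear n_gt0.
pose P m := (m <= K)%N && (level n m s < i + segL M m.+1 s)%N.
have [exP|nP] := pselect (exists m, P m); last first.
  apply: CellMax; rewrite leqNgt; apply/negP => h; apply: nP; exists K.
  by rewrite /P leqnn.
case: (ex_minnP exP) => m /andP[mK Pm] mmin.
have [lm|ml] := ltnP (level n m s) (i + segL M m s)%N; last first.
  by apply: (@CellFill _ _ m) => //; rewrite ml.
apply: (@CellBrk _ _ m) => // m0; rewrite leqNgt; apply/negP => h.
have := mmin m.-1; rewrite /P (leq_trans (leq_pred m) mK) prednK// h => /(_ isT).
lia.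
Qed.

End Thresholds.

(** * Closed form of the control and its optimality certificates *)

Section Control.
Local Open Scope classical_set_scope.
Context {R : realType} {S : finType} (M : model R S).
Hypothesis SA : standing_assumptions M.

Local Notation K := (nbrk M).
Local Notation d := (drain M).
Local Notation ct := (slope M).
Local Notation zM := (zmax M).
Local Notation gamma := (gamma M).
Local Notation level := (level M).
Local Notation critical := (critical M).
Local Notation seg := (seg M).
Local Notation segL := (segL M).
Local Notation txpower := (txpower M).

(* Closed form of [zstar] on [x >= 0]: piece [k] of the power curve is used up
   to the level [b_{n,k}(s)]. *)
Definition control (n : nat) (x : R) (s : S) : R :=
  \sum_(k < K.+1)
    Num.max 0 (Num.min (critical n k s - seg k s - x) (seg k.+1 s - seg k s)).

Variables (n : nat) (Q : R -> R).
Hypotheses (n_gt0 : (0 < n)%N) (HQ : gamma_supports M n Q).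

Let d0 : 0 < d := drain_gt0 SA.

Let le_drain j : (0 < j)%N -> d <= j%:R * d.
Proof. by move=> j0; rewrite -[X in X <= _]mul1r ler_pM2r// ler1n. Qed.

Lemma critical_anti k l s : (k <= l)%N -> (l <= K)%N ->
  critical n l s <= critical n k s.
Proof.
by move=> kl lK; rewrite !criticalE ler_pM2r// ler_nat; exact: (level_anti SA n_gt0 HQ).
Qed.

Let full m x s : (m <= K.+1)%N ->
    ((0 < m)%N -> x <= critical n m.-1 s - seg m s) ->
  \sum_(0 <= k < m)
    Num.max 0 (Num.min (critical n k s - seg k s - x) (seg k.+1 s - seg k s))
    = seg m s.
Proof.
move=> mK xm.
transitivity (\sum_(0 <= k < m) (seg k.+1 s - seg k s)); last first.
  by rewrite telescope_sumr// seg0 subr0.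
apply: eq_big_nat => k /andP[_ km].
have {}xm := xm ltac:(lia).
have c : critical n m.-1 s <= critical n k s by apply: critical_anti; lia.
have h : seg k.+1 s <= seg m s by exact: seg_le.
have h' : seg k s < seg k.+1 s by apply: seg_ltS => //; lia.
rewrite (min_idPr _); last by lra.
by rewrite (max_idPr _)// subr_ge0 ltW.
Qed.

(** Pieces before [m] are full. Pieces after [m] contribute 0: they start no earlier than
    [seg m.+1 s] and their critical level is no higher. *)
Lemma controlE m x s : (m <= K)%N ->
    ((0 < m)%N -> x <= critical n m.-1 s - seg m s) ->
    critical n m s - seg m.+1 s <= x ->
  control n x s = seg m s + Num.max 0 (critical n m s - seg m s - x).
Proof.
move=> mK xm mx; rewrite /control -(big_mkord xpredT (fun k => Num.max 0
  (Num.min (critical n k s - seg k s - x) (seg k.+1 s - seg k s)))).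
rewrite (@big_cat_nat _ _ _ m)//=; last exact: leqW.
rewrite full//; last exact: leqW.
rewrite big_ltn// (min_idPl _); last by lra.
rewrite big_nat_cond big1 ?addr0// => k /andP[/andP[mk kK] _].
have c : critical n k s <= critical n m s by apply: critical_anti => //; lia.
have h : seg m.+1 s <= seg k s by apply: seg_le => //; lia.
by rewrite (max_idPl _)// ge_min; apply/orP; left; lra.
Qed.

Lemma control_max x s : x <= critical n K s - zM s -> control n x s = zM s.
Proof.
move=> xm; rewrite /control -(big_mkord xpredT (fun k => Num.max 0
  (Num.min (critical n k s - seg k s - x) (seg k.+1 s - seg k s)))).
by rewrite full ?seg_max.
Qed.

(** The first piece alone prevents underflow, since its length and [b_{n,0}(s)] are both at least
    [d]. The lengths of all pieces sum to [zM s]. *)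
Lemma control_actions x s : 0 <= x -> actions M x s (control n x s).
Proof.
move=> x0; rewrite /actions/= ge_max; apply/andP; split; first (apply/andP; split).
- by apply: sumr_ge0 => k _; rewrite le_max lexx.
- rewrite /control big_ord_recl/= seg0 subr0.
  have c0 : d <= critical n 0 s.
    by rewrite criticalE le_drain// (level_gt0 SA n_gt0).
  have s1 : d <= seg 1 s.
    have := segL_ltS SA s (leq0n K).
    rewrite seg_mult// segL0 => h.
    exact: le_drain.
  apply: (@le_trans _ _ (Num.max 0 (Num.min (critical n 0 s - x) (seg 1 s - 0)))).
    by rewrite le_max; apply/orP; right; rewrite le_min; apply/andP; split; lra.
  by rewrite lerDl sumr_ge0// => k _; rewrite le_max lexx.
- have -> : zM s = \sum_(k < K.+1) (seg k.+1 s - seg k s).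
    rewrite -(big_mkord xpredT (fun k => seg k.+1 s - seg k s)).
    by rewrite telescope_sumr// seg0 subr0 seg_max.
  apply: ler_sum => k _.
  have h : seg k s < seg k.+1 s by apply: seg_ltS => //; rewrite -ltnS.
  by rewrite ge_max ge_min lexx orbT andbT subr_ge0 ltW.
Qed.

Lemma zstar_case_control x s z : zstar_case M n x s z -> z = control n x s.
Proof.
case=> [k kK kx xk|k kK /andP[kx xk]|/andP[kx xk]|/andP[_ xk]].
- rewrite (@controlE k)//.
  + by rewrite seg_brkp// (max_idPl _) ?addr0//; move: kx; lra.
  + case: k kK kx xk => [//|k] kK kx; rewrite /= -EFinB lee_fin => xk _.
    by rewrite segS.
  + have := seg_ltS SA s kK; rewrite [seg k s]seg_brkp//; move: kx; lra.
- have kK' := ltnW kK.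
  rewrite (@controlE k)// ?segS ?(ltW kx)//.
  + by rewrite seg_brkp// (max_idPr _); move: xk; lra.
  + move=> k0; apply: (le_trans xk); rewrite -seg_brkp// lerD2r.
    by apply: critical_anti => //; lia.
- rewrite (@controlE K)// ?seg_max ?(ltW kx)//.
  + by rewrite seg_brkp// (max_idPr _); move: xk; lra.
  + move=> k0; apply: (le_trans xk); rewrite -seg_brkp// lerD2r.
    by apply: critical_anti => //; lia.
- by rewrite control_max.
Qed.

Lemma control_zstar_case x s : 0 <= x -> zstar_case M n x s (control n x s).
Proof.
move=> x0.
(* The least piece not exhausted at [x] selects the branch; if there is none, [zM s] is sent. *)
pose P m := (m <= K)%N && (critical n m s - seg m.+1 s < x).
have [exP|nP] := pselect (exists m, P m); last first.
  have xK : x <= critical n K s - zM s.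
    rewrite leNgt; apply/negP => h; apply: nP; exists K.
    by rewrite /P leqnn seg_max.
  by rewrite control_max//; apply: ZstarMax; rewrite x0.
case: (ex_minnP exP) => m /andP[mK mx] mmin.
have xm : (0 < m)%N -> x <= critical n m.-1 s - seg m s.
  move=> m0; rewrite leNgt; apply/negP => h.
  have := mmin m.-1; rewrite /P (leq_trans (leq_pred m) mK) prednK// h => /(_ isT).
  lia.
rewrite (controlE mK xm (ltW mx)).
have [lx|xl] := ltP (critical n m s - seg m s) x.
  rewrite (max_idPl _) ?addr0; last by lra.
  rewrite seg_brkp//; apply: ZstarBrk => //; first by rewrite -seg_brkp.
  case: m {mmin mx lx} mK xm => [|m] mK xm; first by rewrite /= oppr0 adde0 leey.
  by rewrite /= -EFinB lee_fin -segS// xm.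
rewrite (max_idPr _); last by lra.
have -> : seg m s + (critical n m s - seg m s - x) = critical n m s - x by ring.
move: (mK); rewrite leq_eqVlt => /predU1P[mE|ltmK].
  rewrite mE; apply: ZstarFillMax; rewrite -seg_max -seg_brkp// -mE mx.
  exact: xl.
by apply: ZstarFill => //; rewrite -segS// mx -seg_brkp.
Qed.

Lemma zstarE x s : 0 <= x -> zstar M n x s = control n x s.
Proof.
move=> x0; apply: zstar_case_control.
by apply: (@xgetI _ _ _ (control n x s)); exact: control_zstar_case.
Qed.

(* Optimality certificate: [lam] is a subgradient of the power curve at [z] and
   [- lam] one of [Q] at [x + z]. *)
Definition certified (x z lam : R) (s : S) : Prop :=
  (forall z', 0 <= z' <= zM s ->
     txpower z s + lam * (z' - z) <= txpower z' s) /\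
  (forall y', d <= y' -> Q (x + z) - lam * (y' - (x + z)) <= Q y').

(** At the kink [j * d] of [Q], the slope [- c] lies between the slopes on the two sides. *)
Lemma gamma_supports_kink j c : 0 < c -> (1 <= j)%N ->
    (gamma n j.+1 <= c%:E < gamma n j)%E ->
  forall y, d <= y -> Q (j%:R * d) - c * (y - j%:R * d) <= Q y.
Proof.
move=> c0 j1 /andP[jc cj] y dy.
have [fin sup far] := HQ.
have jn : (j <= n)%N := lt_gamma_index n_gt0 (ltW c0) j1 cj.
have [jy|yj] := leP (j%:R * d) y.
  suff [mu muc] : exists2 mu, mu <= c & Q (j%:R * d) - mu * (y - j%:R * d) <= Q y.
    apply: le_trans; rewrite lerD2l lerN2 ler_wpM2r// subr_ge0//.
  (* For [j = n] the value [gamma n j.+1 = 0] is only a convention; the nonpositive multiplier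
     available from [n * d] on replaces it. *)
  have [jn'|nj] := ltnP j n.
    exists (fine (gamma n j.+1)).
      by rewrite -lee_fin fineK// fin.
    by apply: sup; rewrite //= ?lexx ?ler_pM2r ?ler_nat//; lia.
  have [|mu mu0 h]  := far (j%:R * d); first by rewrite ler_pM2r// ler_nat.
  by exists mu; [lra|exact: h].
have j2 : (2 <= j)%N.
  case: j j1 yj {jc cj jn} => [//|[|//]] _; rewrite mul1r; lra.
have cg : c < fine (gamma n j) by rewrite -lte_fin fineK// fin.
have h : Q (j%:R * d) - fine (gamma n j) * (y - j%:R * d) <= Q y.
  by apply: sup => //; rewrite ?j2// lexx andbT ler_pM2r// ler_nat leq_pred.
apply: le_trans h; rewrite lerD2l lerN2 -subr_ge0 -mulrBl.
by rewrite -mulrNN mulr_ge0// oppr_ge0; lra.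
Qed.

Section Cell.
Variables (i : nat) (x : R) (s : S).
Hypotheses (i_gt0 : (0 < i)%N) (xi : i.-1%:R * d <= x <= i%:R * d).

Let i1E : (i.-1)%:R = i%:R - 1 :> R.
Proof. by rewrite -(natrB _ i_gt0) subn1. Qed.

Let le_crit k m : (k <= K)%N -> (m <= K.+1)%N ->
    (i + segL m s <= level n k s)%N ->
  x <= critical n k s - seg m s.
Proof.
move=> kK mK h; rewrite seg_mult// criticalE.
have : (i + segL m s)%:R * d <= (level n k s)%:R * d by rewrite ler_pM2r ?ler_nat.
by rewrite natrD mulrDl; move: xi => /andP[_]; lra.
Qed.

(** A strict inequality between integers leaves a whole unit [d], so the lower end [i.-1 * d] of the
    interval suffices. *)
Let crit_le k m : (k <= K)%N -> (m <= K.+1)%N ->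
    (level n k s < i + segL m s)%N ->
  critical n k s - seg m s <= x.
Proof.
move=> kK mK h; rewrite seg_mult// criticalE.
have : (level n k s).+1%:R * d <= (i + segL m s)%:R * d by rewrite ler_pM2r ?ler_nat.
by rewrite natrD -natr1 !mulrDl; move: xi => /andP[+ _]; rewrite i1E mulrBl; lra.
Qed.

Let xseg m : (m <= K.+1)%N ->
  (i + segL m s).-1%:R * d <= x + seg m s <= (i + segL m s)%:R * d.
Proof.
move=> mK; rewrite seg_mult// !natrD.
have -> : ((i + segL m s).-1 = i.-1 + segL m s)%N by lia.
by rewrite natrD !mulrDl !lerD2r.
Qed.

(** The threshold of the interval containing [x + seg m s] lies between [ct m.-1 s] and [ct m s],
    hence is a subgradient of the power curve at this breakpoint. For [m = 0] only [z' >= 0]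
    competes, and the upper bound is enough. *)
Lemma certified_brk m : (m <= K)%N -> (level n m s < i + segL m s)%N ->
    ((0 < m)%N -> (i + segL m s <= level n m.-1 s)%N) ->
    (i + segL m s <= n)%N ->
  certified x (control n x s) (fine (gamma n (i + segL m s))) s.
Proof.
move=> mK lm ml imn.
have [fin sup far] := HQ.
have l0 := level_gt0 SA n_gt0 s mK.
have im2 : (2 <= i + segL m s)%N by lia.
have mK1 : (m <= K.+1)%N by lia.
have zE : control n x s = seg m s.
  rewrite (@controlE m)//.
  - by rewrite (max_idPl _) ?addr0// subr_le0; apply: crit_le.
  - by move=> m0; apply: le_crit; [lia|lia|exact: ml].
  - by apply: le_trans (crit_le mK mK1 lm); rewrite lerD2l lerN2 ltW// seg_ltS.
rewrite zE; split; last by move=> y' dy'; apply: sup => //; [lia|exact: xseg].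
move=> z' /andP[z'0 _].
have ge : fine (gamma n (i + segL m s)) <= ct m s.
  by rewrite -lee_fin fineK ?fin// (ge_gammaE SA n_gt0 HQ)//; lia.
have [zz'|z'z] := leP (seg m s) z'.
  apply: le_trans (txpower_support SA (k := m) (z := seg m s) _ _ _) => //.
    by rewrite lerD2l ler_wpM2r// subr_ge0.
  by rewrite lexx ltW// seg_ltS.
have m0 : (0 < m)%N by case: m z'z {lm ml imn im2 mK1 mK l0 zE ge} => //; rewrite seg0; lra.
have lt : ct m.-1 s < fine (gamma n (i + segL m s)).
  by rewrite -lte_fin fineK ?fin// (lt_gammaE SA n_gt0 HQ)//; [exact: ml|lia|lia].
apply: le_trans (txpower_support SA (k := m.-1) (z := seg m s) _ _ _) => //; last 2 first.
- by lia.
- by rewrite prednK// lexx andbT; apply: seg_le => //; lia.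
by rewrite lerD2l -subr_ge0 -mulrBl -mulrNN mulr_ge0// oppr_ge0; lra.
Qed.

(** Here [x + z] lands exactly on the kink [b_{n,m}(s)] of [Q], where the slope [- ct m s]
    supports. *)
Lemma certified_fill m : (m <= K)%N ->
    (i + segL m s <= level n m s < i + segL m.+1 s)%N ->
  certified x (control n x s) (ct m s) s.
Proof.
move=> mK /andP[ml lm].
have zE : control n x s = critical n m s - x.
  rewrite (@controlE m)//.
  - rewrite (max_idPr _); first by ring.
    by rewrite subr_ge0; apply: le_crit => //; lia.
  - move=> m0; apply: le_crit; [lia|lia|].
    by apply: (leq_trans ml); apply: (level_anti SA n_gt0 HQ) => //; lia.
  - by apply: crit_le.
rewrite zE; split.
  move=> z' _; apply: txpower_support => //.
  have := @le_crit m m mK (leqW mK) ml; have := @crit_le m m.+1 mK mK lm.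
  by move=> h1 h2; apply/andP; split; lra.
rewrite addrCA subrr addr0 criticalE.
by have [l1 l2] := levelP SA n_gt0 s mK; apply: gamma_supports_kink => //; exact: slope_gt0.
Qed.

(** The threshold exceeds the last slope [ct K s]; it still supports the power curve because only
    [z' <= zM s] competes. *)
Lemma certified_max : (i + segL K.+1 s <= level n K s)%N ->
  certified x (control n x s) (fine (gamma n (i + segL K.+1 s))) s.
Proof.
move=> iK.
have [fin sup far] := HQ.
have lt : ((ct K s)%:E < gamma n (i + segL K.+1 s))%E.
  by rewrite (lt_gammaE SA n_gt0 HQ)//; lia.
have sK := segL_ltS SA s (leqnn K).
have im2 : (2 <= i + segL K.+1 s)%N by lia.
have imn : (i + segL K.+1 s <= n)%N.
  by apply: (lt_gamma_index n_gt0 _ _ lt); [apply/ltW/slope_gt0|lia].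
have zE : control n x s = zM s by rewrite control_max// -seg_max; apply: le_crit.
rewrite zE; split; last first.
  by move=> y' dy'; apply: sup => //; [lia|rewrite -seg_max; exact: xseg].
move=> z' /andP[z'0 z'M].
have ltf : ct K s < fine (gamma n (i + segL K.+1 s)) by rewrite -lte_fin fineK ?fin.
apply: le_trans (txpower_support SA (k := K) (z := zM s) _ _ _) => //.
  by rewrite lerD2l -subr_ge0 -mulrBl -mulrNN mulr_ge0// oppr_ge0; lra.
by rewrite seg_max lexx andbT -seg_max ltW// seg_ltS.
Qed.

End Cell.

(** Nothing is sent from [n * d] on: a further packet has marginal value [mu <= 0], while its power
    costs at least [ct 0 s > 0]. *)
Lemma certified_far x s : n%:R * d <= x ->
  exists2 mu, mu <= 0 & certified x (control n x s) mu s.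
Proof.
move=> nx; have [fin sup far] := HQ.
have l0 : (level n 0 s <= n)%N.
  have [l1 /andP[_ l2]] := levelP SA n_gt0 s (leq0n K).
  by apply: (lt_gamma_index n_gt0 _ _ l2) => //; apply/ltW/slope_gt0.
have cx : critical n 0 s <= x.
  by apply: le_trans nx; rewrite criticalE ler_pM2r ?ler_nat.
have zE : control n x s = 0.
  rewrite (@controlE 0%N)//.
    by rewrite seg0 subr0 add0r (max_idPl _) ?subr_le0.
  apply: le_trans cx; rewrite gerBl ltW// -(seg0 M s).
  exact: seg_ltS.
have [mu mu0 h] := far _ nx; exists mu => //; rewrite zE; split.
  move=> z' /andP[z'0 _].
  have := txpower_support SA (k := 0%N) (z := 0) z' (s := s) (leq0n K).
  rewrite {1}seg0 lexx/= -(seg0 M s) ltW ?seg_ltS// seg0 => /(_ isT).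
  apply: le_trans; rewrite lerD2l subr0 ler_wpM2r//.
  by apply: (le_trans mu0); apply/ltW/slope_gt0.
by rewrite addr0.
Qed.

End Control.

(** * The threshold recursion, one channel condition at a time *)

Section Recursion.
Context {R : realType} {S : finType} (M : model R S).
Hypothesis SA : standing_assumptions M.

Local Notation K := (nbrk M).
Local Notation p := (prob M).
Local Notation ct := (slope M).
Local Notation h := (hold M).
Local Notation alpha := (disc M).
Local Notation gamma := (gamma M).
Local Notation level := (level M).
Local Notation segL := (segL M).

Local Open Scope ereal_scope.

(** The recursion sums over channels within each case. Exchanging the sums isolates the share of one
    channel, in which a single case survives. *)
Definition gamma_term (n i : nat) (s : S) : \bar R :=
  let g l := gamma n (i + l)%N in
  (if g 0%N <= (ct 0 s)%:E then (p s)%:E * g 0%N else 0)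
  + \sum_(k < K)
      ((if g (Lbrk M k s) <= (ct k s)%:E < g (Lbrkp M k s)
        then (p s)%:E * (ct k s)%:E else 0)
       + (if (ct k s)%:E < g (Lbrk M k s) <= (ct k.+1 s)%:E
          then (p s)%:E * g (Lbrk M k s) else 0))
  + (if g (Lmax M s) <= (ct K s)%:E < g (Lbrkp M K s)
     then (p s)%:E * (ct K s)%:E else 0)
  + (if (ct K s)%:E < g (Lmax M s) then (p s)%:E * g (Lmax M s) else 0).

Lemma gammaS n i : (0 < i <= n)%N ->
  gamma n.+1 i.+1 = - h%:E + alpha%:E * \sum_s gamma_term n i s.
Proof.
move=> /andP[i0 iN]; rewrite /= eqSS gtn_eqF// ltnS ltnNge iN/=.
congr (_ + _ * _); rewrite [in RHS]/gamma_term 3![in RHS]big_split/=.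
rewrite [in RHS]exchange_big/=.
congr (_ + _ + _ + _); try by rewrite big_mkcond.
by apply: eq_bigr => k _; rewrite big_split/=; congr (_ + _); rewrite big_mkcond.
Qed.

Variables (n : nat) (Q : R -> R).
Hypotheses (n_gt0 : (0 < n)%N) (HQ : gamma_supports M n Q).
Variables (i : nat) (s : S).
Hypothesis i_gt0 : (0 < i)%N.

Let lv k := level n k s.
Let L k := segL k s.

Let termE : gamma_term n i s =
  (if (lv 0 < i)%N then (p s)%:E * gamma n i else 0)
  + \sum_(k < K)
      ((if (lv k < i + L k.+1)%N && (i + L k <= lv k)%N
        then (p s)%:E * (ct k s)%:E else 0)
       + (if (i + L k.+1 <= lv k)%N && (lv k.+1 < i + L k.+1)%N
          then (p s)%:E * gamma n (i + L k.+1) else 0))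
  + (if (lv K < i + L K.+1)%N && (i + L K <= lv K)%N
     then (p s)%:E * (ct K s)%:E else 0)
  + (if (i + L K.+1 <= lv K)%N then (p s)%:E * gamma n (i + L K.+1) else 0).
Proof.
have ig l : (0 < i + l)%N by rewrite addn_gt0 i_gt0.
have LM : Lmax M s = L K.+1 by rewrite /L /segL seg_max.
have LB k : (k < K)%N -> Lbrk M k s = L k.+1 by move=> kK; rewrite /L /segL segS.
have LP k : (k <= K)%N -> Lbrkp M k s = L k by move=> kK; rewrite /L /segL seg_brkp.
rewrite /gamma_term LM LP// !(ge_gammaE SA n_gt0 HQ)// !(lt_gammaE SA n_gt0 HQ)//.
rewrite addn0; congr (_ + _ + _ + _); apply: eq_bigr => k _.
have kK := ltn_ord k; have kK' := ltnW kK.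
by rewrite LB// LP// !(ge_gammaE SA n_gt0 HQ)// !(lt_gammaE SA n_gt0 HQ).
Qed.

Let Lle k l : (k <= l)%N -> (l <= K.+1)%N -> (L k <= L l)%N.
Proof. exact: segL_le. Qed.

Let LltS k : (k <= K)%N -> (L k < L k.+1)%N.
Proof. exact: segL_ltS. Qed.

Let lvle k l : (k <= l)%N -> (l <= K)%N -> (lv l <= lv k)%N.
Proof. exact: (level_anti SA n_gt0 HQ). Qed.

Let L0 : L 0%N = 0%N. Proof. exact: segL0. Qed.

Lemma gamma_term_brk m : (m <= K)%N -> (lv m < i + L m)%N ->
    ((0 < m)%N -> (i + L m <= lv m.-1)%N) ->
  gamma_term n i s = (p s)%:E * gamma n (i + L m).
Proof.
move=> mK lm ml; rewrite termE.
have LK := Lle (leqW mK) (leqnn _); have lK := lvle mK (leqnn _).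
have KL := LltS (leqnn K).
have mLK : (L m <= L K)%N by apply: Lle => //; exact: leqW.
rewrite [X in _ + X]ifF ?adde0; last by lia.
rewrite [X in _ + X]ifF ?adde0; last by lia.
case: m => [|m] in mK lm ml LK lK mLK *.
  rewrite ifT ?L0 ?addn0; last by rewrite L0 addn0 in lm.
  rewrite big1 ?adde0// => k _; have kK := ltn_ord k.
  have a := lvle (leq0n k) (ltnW kK).
  have b : (L 0%N <= L k)%N by apply: Lle => //; lia.
  have c := LltS (ltnW kK).
  by rewrite !ifF ?adde0//; lia.
have {}ml : (i + L m.+1 <= lv m)%N := ml isT.
rewrite ifF ?add0e; last by have := @lvle 0%N m (leq0n _) ltac:(lia); lia.
(* Breakpoint [m.+1] is the upper end of piece [m], so it is the second summand at index [m]. *)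
rewrite (bigD1 (Ordinal mK))//= [X in X + _ + _]ifF; last by move=> /=; lia.
rewrite ifT; last by rewrite ml lm.
rewrite add0e big1 ?adde0// => k km.
have kK := ltn_ord k; have {}km : (k : nat) != m.
  by apply: contra km => /eqP km; apply/eqP/val_inj.
have c := LltS (ltnW kK).
have [lt|ge] := ltnP k m.
  have a : (lv m <= lv k.+1)%N by apply: lvle => //; lia.
  have a' : (lv k.+1 <= lv k)%N by apply: lvle.
  have b : (L k.+1 <= L m.+1)%N by apply: Lle => //; lia.
  by rewrite !ifF ?adde0//; lia.
have a : (lv k <= lv m.+1)%N by apply: lvle => //; lia.
have b : (L m.+1 <= L k)%N by apply: Lle => //; lia.
by rewrite !ifF ?adde0//; lia.
Qed.

Lemma gamma_term_fill m : (m <= K)%N -> (i + L m <= lv m < i + L m.+1)%N ->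
  gamma_term n i s = (p s)%:E * (ct m s)%:E.
Proof.
move=> mK /andP[ml lm]; rewrite termE.
have lv0 := lvle (leq0n m) mK.
rewrite ifF ?add0e; last by lia.
have LK : (L m.+1 <= L K.+1)%N by apply: Lle.
have lK := lvle mK (leqnn _).
rewrite [X in _ + X]ifF ?adde0; last by lia.
have off k : (k < K)%N -> k != m ->
    (if (lv k < i + L k.+1)%N && (i + L k <= lv k)%N
        then (p s)%:E * (ct k s)%:E else 0)
       + (if (i + L k.+1 <= lv k)%N && (lv k.+1 < i + L k.+1)%N
          then (p s)%:E * gamma n (i + L k.+1) else 0) = 0.
  move=> kK km; have c := LltS (ltnW kK).
  have [lt|ge] := ltnP k m.
    have a : (lv m <= lv k.+1)%N by apply: lvle => //; lia.
    have a' : (lv k.+1 <= lv k)%N by apply: lvle.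
    have b : (L k.+1 <= L m)%N by apply: Lle => //; lia.
    by rewrite !ifF ?adde0//; lia.
  have a : (lv k <= lv m)%N by apply: lvle => //; lia.
  have b : (L m.+1 <= L k)%N by apply: Lle => //; lia.
  by rewrite !ifF ?adde0//; lia.
(* The last piece lies outside the sum over [k < K], in a term of its own. *)
move: (mK); rewrite leq_eqVlt => /predU1P[mE|ltmK].
  rewrite big1 ?add0e; last by move=> k _; apply: off => //; rewrite mE ltn_eqF.
  by rewrite -mE ifT// lm ml.
rewrite [X in _ + X]ifF ?adde0; last first.
  by have : (L m.+1 <= L K)%N by [apply: Lle => //; lia]; lia.
rewrite (bigD1 (Ordinal ltmK))//= ifT ?lm ?ml// ifF ?adde0; last by lia.
by rewrite big1 ?adde0// => k km; apply: off.
Qed.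

Lemma gamma_term_max : (i + L K.+1 <= lv K)%N ->
  gamma_term n i s = (p s)%:E * gamma n (i + L K.+1).
Proof.
move=> lK; rewrite termE lK.
have l0 := lvle (leq0n K) (leqnn K).
rewrite ifF ?add0e; last by lia.
rewrite big1 ?add0e; last first.
  move=> k _; have kK := ltn_ord k; have c := LltS (ltnW kK).
  have a : (lv K <= lv k.+1)%N by apply: lvle.
  have a' : (lv k.+1 <= lv k)%N by apply: lvle.
  have b : (L k.+1 <= L K.+1)%N by apply: Lle => //; lia.
  by rewrite !ifF ?adde0//; lia.
by rewrite ifF ?add0e//; lia.
Qed.

End Recursion.

(** * Cost-to-go and induction on the number of slots *)

Section Value.
Context {R : realType} {S : finType} (M : model R S).
Hypothesis SA : standing_assumptions M.

Local Notation K := (nbrk M).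
Local Notation p := (prob M).
Local Notation d := (drain M).
Local Notation ct := (slope M).
Local Notation h := (hold M).
Local Notation alpha := (disc M).
Local Notation gamma := (gamma M).
Local Notation txpower := (txpower M).
Local Notation control := (control M).

(** The terms in [z] and [z'] cancel when the two support inequalities are added. Taking [x' = x]
    gives optimality of [z]; varying [x'] gives a support inequality in the buffer level. *)
Lemma certified_le Q x z lam s x' z' : certified M Q x z lam s ->
    actions M x' s z' ->
  txpower z s + Q (x + z) - lam * (x' - x) <= txpower z' s + Q (x' + z').
Proof.
move=> [cz cQ] /andP[]; rewrite ge_max => /andP[z0 dz] zM'.
have := cz z'; rewrite z0 zM' => /(_ isT) h1.
have := cQ (x' + z') ltac:(lra).
by lra.
Qed.

Lemma gamma_term_certified n Q i s : (0 < n)%N -> gamma_supports M n Q ->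
    (0 < i <= n)%N ->
  exists lam, gamma_term M n i s = (p s * lam)%:E /\
    forall x, i.-1%:R * d <= x <= i%:R * d ->
      certified M Q x (control n x s) lam s.
Proof.
move=> n0 HQ /andP[i0 iN]; have [fin _ _] := HQ.
case: (cellP M n i s) => [m mK lm ml|m mK lml|iK].
- have l0 := level_gt0 SA n0 s mK.
  (* For [m > 0] the bound comes from [level n m.-1 s <= n], since thresholds beyond [n] vanish. *)
  have imn : (i + segL M m s <= n)%N.
    case: m mK lm ml l0 => [|m] mK lm ml l0; first by rewrite segL0 addn0.
    apply: (leq_trans (ml isT)) => /=.
    have [l1 /andP[_ l2]] := levelP SA n0 s (ltnW mK).
    by apply: (lt_gamma_index n0 _ _ l2) => //; apply/ltW/slope_gt0 => //; exact: ltnW.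
  exists (fine (gamma n (i + segL M m s))); split.
    by rewrite (gamma_term_brk SA n0 HQ i0 mK lm ml) EFinM fineK// fin//; lia.
  by move=> x xi; apply: certified_brk.
- exists (ct m s); split; first by rewrite (gamma_term_fill SA n0 HQ i0 mK lml).
  by move=> x xi; apply: (certified_fill SA n0 HQ i0 xi mK lml).
- have sK := segL_ltS SA s (leqnn K).
  exists (fine (gamma n (i + segL M K.+1 s))); split.
    by rewrite (gamma_term_max SA n0 HQ i0 iK) EFinM fineK// fin//; lia.
  by move=> x xi; apply: certified_max.
Qed.

(** Defined as the cost of following [control] rather than as an infimum; that no action does better
    is [control_optimal]. *)
Fixpoint value (n : nat) (x : R) : R :=
  if n is n'.+1 then
    \sum_s p s * (txpower (control n x s) s
      + (h * (x + control n x s - d) + alpha * value n' (x + control n x s - d)))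
  else 0.

(** The function [Q] of the induction; [y] is the level after transmission and before the drain. *)
Definition onward (n : nat) (y : R) : R :=
  h * (y - d) + alpha * value n.-1 (y - d).

Lemma valueS n x : value n.+1 x =
  \sum_s p s *
    (txpower (control n.+1 x s) s + onward n.+1 (x + control n.+1 x s)).
Proof. by []. Qed.

Lemma value_support n (lam : S -> R) x x' : (0 < n)%N ->
    gamma_supports M n (onward n) ->
    (forall s, certified M (onward n) x (control n x s) (lam s) s) -> 0 <= x' ->
  value n x - (\sum_s p s * lam s) * (x' - x) <= value n x'.
Proof.
case: n => [//|n] n0 HQ cert x'0; rewrite !valueS mulr_suml -sumrB.
apply: ler_sum => s _; rewrite -mulrA -mulrBr ler_wpM2l ?(prob_ge0 SA)//.
exact: (certified_le (cert s) (control_actions SA n0 s x'0)).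
Qed.

Lemma onward_gamma_supports n : gamma_supports M n.+1 (onward n.+1).
Proof.
have h0 := hold_ge0 SA; have /andP[a0 _] := disc_itv SA.
have d0 := drain_gt0 SA.
elim: n => [|n IH].
  split.
  - by move=> j j2; rewrite gamma_gt.
  - by move=> j y y' j2; exfalso; lia.
  - move=> y _; exists (- h); rewrite ?oppr_le0// => y' _.
    by rewrite /onward/= mulr0; lra.
(* One multiplier [lam s] per channel serves the whole [i]-th interval; its mean is the sum in the
   recursion. *)
have lamP i : (0 < i <= n.+1)%N -> exists lam : S -> R,
    gamma n.+2 i.+1 = (- h + alpha * (\sum_s p s * lam s))%:E /\
    forall x s, i.-1%:R * d <= x <= i%:R * d ->
      certified M (onward n.+1) x (control n.+1 x s) (lam s) s.
  move=> iN.
  have /choice[lam lamP] := fun s => gamma_term_certified s (ltn0Sn n) IH iN.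
  exists lam; split; last by move=> x s; exact: (lamP s).2.
  rewrite gammaS//; under eq_bigr do rewrite (lamP _).1.
  by rewrite sumEFin.
split.
- move=> [//|i] i2; have [iN|Ni] := leqP i.+1 n.+2; last by rewrite gamma_gt.
  by have [|lam [-> _]] := lamP i; first by lia.
- move=> [//|i] y y' iN yi dy'.
  have [|lam [-> cert]] := lamP i; first by lia.
  rewrite [_.-1]/= in yi.
  (* Draining [d] shifts the interval by one, which is the index shift from [i] to [i.+1] in the
     recursion. *)
  have yi' : i.-1%:R * d <= y - d <= i%:R * d.
    have e1 : i%:R * d = i.-1%:R * d + d.
      by rewrite -[in LHS](@prednK i) -?natr1 ?mulrDl ?mul1r//; lia.
    have e2 : i.+1%:R * d = i%:R * d + d by rewrite -natr1 mulrDl mul1r.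
    by move: yi => /andP[? ?]; apply/andP; split; lra.
  have dy'0 : 0 <= y' - d by lra.
  have := value_support (ltn0Sn n) IH (cert (y - d) ^~ yi') dy'0.
  move=> /(ler_wpM2l a0); rewrite /onward/=; set V := value _.
  by lra.
- move=> y ny.
  have ny' : n.+1%:R * d <= y - d by move: ny; rewrite -natr1 mulrDl mul1r; lra.
  have far s : exists mu, mu <= 0 /\
      certified M (onward n.+1) (y - d) (control n.+1 (y - d) s) mu s.
    by have [mu mu0 cert] := certified_far SA (ltn0Sn n) IH s ny'; exists mu.
  have /choice[mu muP] := far.
  exists (- h + alpha * (\sum_s p s * mu s)).
    rewrite -subr_ge0 sub0r opprD opprK addr_ge0// -mulrN mulr_ge0//.
    rewrite oppr_ge0 sumr_le0// => s _.
    by rewrite mulr_ge0_le0 ?(prob_ge0 SA)//; exact: (muP s).1.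
  move=> y' dy'.
  have := @value_support n.+1 mu (y - d) (y' - d) isT IH (fun s => (muP s).2) ltac:(lra).
  move=> /(ler_wpM2l a0); rewrite /onward/=; set V := value _.
  by lra.
Qed.

Lemma control_optimal n x s z : (0 < n)%N -> 0 <= x -> actions M x s z ->
  txpower (control n x s) s + onward n (x + control n x s)
    <= txpower z s + onward n (x + z).
Proof.
case: n => [//|n] n0 x0 xz; have HQ := onward_gamma_supports n.
have d0 := drain_gt0 SA.
suff [lam cert] : exists lam, certified M (onward n.+1) x (control n.+1 x s) lam s.
  by have := certified_le cert xz; rewrite subrr mulr0 subr0.
have [nx|xn] := leP (n.+1%:R * d) x.
  by have [mu _ ?] := certified_far SA n0 HQ s nx; exists mu.
(* Intervals are numbered from 1, hence the successor. *)
pose i := (Num.truncn (x / d)).+1.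
have xd0 : 0 <= x / d by rewrite divr_ge0// ltW.
have [i1 i2] : i.-1%:R * d <= x /\ x < i%:R * d.
  by rewrite -ler_pdivlMr// -ltr_pdivrMr// truncn_le// truncnS_gt.
have iN : (0 < i <= n.+1)%N.
  rewrite /= -ltnS -(ltr_nat R) -(ltr_pM2r d0).
  have : i.-1%:R * d < n.+1%:R * d by exact: le_lt_trans xn.
  by rewrite !ltr_pM2r// !ltr_nat /=; lia.
have [lam [_ cert]] := gamma_term_certified s n0 HQ iN.
by exists lam; apply: cert; rewrite i1 ltW.
Qed.

End Value.

(** * Expected cost of history-dependent policies *)

Section Policies.
Local Open Scope classical_set_scope.
Context {R : realType} {S : finType} (M : model R S).
Hypothesis SA : standing_assumptions M.

Local Notation N := (horizon M).
Local Notation p := (prob M).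
Local Notation d := (drain M).
Local Notation h := (hold M).
Local Notation alpha := (disc M).
Local Notation txpower := (txpower M).
Local Notation control := (control M).
Local Notation value := (value M).
Local Notation buffer := (buffer M).
Local Notation total_cost := (@total_cost R S M).

Lemma buffer_rcons zeta z : buffer (rcons zeta z) = buffer zeta + z - d.
Proof. by rewrite /buffer foldl_rcons. Qed.

Lemma feasible_rcons t (sigma : t.-tuple S) (zeta : t.-tuple R) s z :
    feasible_history M sigma zeta -> actions M (buffer zeta) s z ->
  feasible_history M [tuple of rcons sigma s] [tuple of rcons zeta z].
Proof.
move=> fz az i; rewrite !(tnth_nth s) !(tnth_nth 0) /= !nth_rcons !size_tuple.
have [it|ti|it] := ltngtP i t; last 2 first.
- by have := ltn_ord i; rewrite ltnS leqNgt ti.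
- by rewrite it -cats1 take_size_cat ?size_tuple.
rewrite -cats1 takel_cat ?size_tuple ?(ltnW it)//.
by have := fz (Ordinal it); rewrite (tnth_nth s) (tnth_nth 0).
Qed.

Lemma total_cost_rcons t (sigma : t.-tuple S) (zeta : t.-tuple R) s z :
  total_cost [tuple of rcons sigma s] [tuple of rcons zeta z] =
  total_cost sigma zeta
    + alpha ^+ t * (txpower z s + h * (buffer zeta + z - d)).
Proof.
rewrite /Defs.total_cost big_ord_recr/=; congr (_ + _).
  apply: eq_bigr => i _; have it := ltn_ord i.
  rewrite !(tnth_nth s) !(tnth_nth 0) /= !nth_rcons !size_tuple it.
  by rewrite -cats1 takel_cat ?size_tuple ?(ltnW it).
rewrite !(tnth_nth s) !(tnth_nth 0) /= !nth_rcons !size_tuple ltnn eqxx.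
by rewrite -cats1 take_size_cat ?size_tuple.
Qed.

Lemma actions_ge0 x s z : actions M x s z -> 0 <= z /\ 0 <= x + z - d.
Proof. by move=> /andP[]; rewrite ge_max => /andP[? ?] _; split; lra. Qed.

Lemma buffer_ge0 t (sigma : t.-tuple S) (zeta : t.-tuple R) :
  feasible_history M sigma zeta -> 0 <= buffer zeta.
Proof.
case: t sigma zeta => [|t] sigma zeta fz; first by rewrite (tuple0 zeta).
have := (actions_ge0 (fz ord_max)).2; rewrite (tnth_nth 0)/= -buffer_rcons.
by rewrite -take_nth ?size_tuple// take_oversize ?size_tuple.
Qed.

Lemma disc_exp_ge0 t : 0 <= alpha ^+ t.
Proof. by rewrite exprn_ge0//; have /andP[] := disc_itv SA. Qed.

Lemma total_cost_ge0 t (sigma : t.-tuple S) (zeta : t.-tuple R) :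
  feasible_history M sigma zeta -> 0 <= total_cost sigma zeta.
Proof.
move=> fz; apply: sumr_ge0 => i _; have [z0 y0] := actions_ge0 (fz i).
by rewrite mulr_ge0 ?disc_exp_ge0// addr_ge0 ?txpower_ge0// mulr_ge0 ?(hold_ge0 SA).
Qed.

Lemma value_ge0 n x : 0 <= x -> 0 <= value n x.
Proof.
elim: n x => [//|n IH] x x0 /=; apply: sumr_ge0 => s _.
have [z0 y0] := actions_ge0 (control_actions SA (ltn0Sn n) s x0).
rewrite mulr_ge0 ?(prob_ge0 SA)// addr_ge0 ?txpower_ge0// addr_ge0//.
  by rewrite mulr_ge0 ?(hold_ge0 SA).
by rewrite mulr_ge0 ?IH//; have /andP[] := disc_itv SA.
Qed.

(** Matches the average over channels in [expectation]; the constant moves inside as the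
    probabilities sum to 1. *)
Lemma cost_to_go_expand t n (C : R) x :
  C + alpha ^+ t * value n.+1 x =
  \sum_s p s * (C + alpha ^+ t *
    (txpower (control n.+1 x s) s + onward M n.+1 (x + control n.+1 x s))).
Proof.
under [RHS]eq_bigr do rewrite mulrDr mulrCA.
by rewrite big_split/= -mulr_suml (prob_sum1 SA) mul1r -mulr_sumr.
Qed.

(** Induction on the remaining slots for an arbitrary feasible history, whose cost is carried along.
    Admissibility concentrates the kernel on [actions], where [control_optimal] bounds the integrand
    from below. *)
Lemma expectation_ge (pi : @policy R S) m t
    (sigma : t.-tuple S) (zeta : t.-tuple R) :
    admissible M pi -> (t + m)%N = N -> feasible_history M sigma zeta ->
  ((total_cost sigma zeta + alpha ^+ t * value m (buffer zeta))%:E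
    <= expectation M pi total_cost m sigma zeta)%E.
Proof.
move=> api; elim: m t sigma zeta => [|m IH] t sigma zeta tmN fz.
  by rewrite /= mulr0 addr0.
have x0 := buffer_ge0 fz.
rewrite cost_to_go_expand -sumEFin; apply: lee_sum => s _.
rewrite EFinM; apply: lee_wpmul2l; first by rewrite lee_fin (prob_ge0 SA).
have A1 := api t sigma s zeta ltac:(lia) fz.
have mA : measurable (actions M (buffer zeta) s : set (measurableTypeR R)).
  rewrite (_ : actions _ _ _ = `[Num.max 0 (d - buffer zeta), zmax M s]%classic).
    exact: measurable_itv.
  by apply/seteqP; split => z /=; rewrite in_itv.
have AT := prob_kernel (s := pi t sigma s) zeta.
have [z0 y0] := actions_ge0 (control_actions SA (ltn0Sn m) s x0).
apply: (integral_ge_concentrated mA AT A1).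
  rewrite addr_ge0 ?total_cost_ge0// mulr_ge0 ?disc_exp_ge0//.
  rewrite addr_ge0 ?txpower_ge0// addr_ge0// mulr_ge0 ?value_ge0 ?(hold_ge0 SA)//.
  by have /andP[] := disc_itv SA.
move=> z az; apply: le_trans (IH _ _ _ _ (feasible_rcons fz az)); last by lia.
rewrite lee_fin total_cost_rcons /= buffer_rcons -[leRHS]addrA lerD2l.
rewrite exprSr -mulrA -mulrDr ler_wpM2l ?disc_exp_ge0// -[leRHS]addrA.
exact: control_optimal.
Qed.

(** The closed form pays off: [buffer] is a sum over coordinates, and [control] a sum of maxima and
    minima. *)
Lemma measurable_control_buffer n s t :
  measurable_fun [set: t.-tuple (measurableTypeR R)]
    (fun zeta => control n (buffer zeta) s : measurableTypeR R).
Proof.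
have mb : measurable_fun [set: t.-tuple (measurableTypeR R)]
    (fun zeta => buffer zeta : measurableTypeR R).
  rewrite (_ : (fun zeta => _) = fun zeta : t.-tuple (measurableTypeR R) =>
      \sum_(i < t) (tnth zeta i - d)); last first.
    apply/funext => zeta; rewrite -(big_tuple _ _ _ xpredT (fun z => z - d)).
    elim/last_ind: (tval zeta) => [|l z IH]; first by rewrite big_nil.
    by rewrite buffer_rcons IH -cats1 big_cat big_seq1/= addrA.
  apply: measurable_sum => i; apply: measurable_funB => //.
  exact: measurable_tnth.
apply: measurable_sum => k; apply: measurable_maxr => //.
by apply: measurable_minr => //; apply: measurable_funB.
Qed.

Definition control_policy : @policy R S :=
  fun t sigma s => kdirac (measurable_control_buffer (N - t) s (t := t)).

Lemma control_policyE t (sigma : t.-tuple S) s (zeta : t.-tuple R) A :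
  control_policy sigma s zeta A = (\d_(control (N - t) (buffer zeta) s) A)%E.
Proof. by []. Qed.

Lemma control_policy_admissible : admissible M control_policy.
Proof.
move=> t sigma s zeta tN fz; rewrite control_policyE diracE mem_set//.
by apply: control_actions => //; [rewrite subn_gt0|exact: buffer_ge0 fz].
Qed.

(** The same induction with equality, as a Dirac kernel is concentrated on a singleton. *)
Lemma expectation_control m t (sigma : t.-tuple S) (zeta : t.-tuple R) :
    (t + m)%N = N -> feasible_history M sigma zeta ->
  expectation M control_policy total_cost m sigma zeta
    = (total_cost sigma zeta + alpha ^+ t * value m (buffer zeta))%:E.
Proof.
elim: m t sigma zeta => [|m IH] t sigma zeta tmN fz.
  by rewrite /= mulr0 addr0.
have x0 := buffer_ge0 fz.
rewrite cost_to_go_expand -sumEFin; apply: eq_bigr => s _.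
rewrite EFinM; congr (_ * _)%E.
have nE : (N - t = m.+1)%N by lia.
have az := control_actions SA (ltn0Sn m) s x0.
have [z0 y0] := actions_ge0 az.
have mA : measurable ([set control (N - t) (buffer zeta) s] : set (measurableTypeR R)).
  exact: measurable_set1.
have A1 : control_policy sigma s zeta [set control (N - t) (buffer zeta) s] = 1%E.
  by rewrite control_policyE diracE mem_set.
have AT := prob_kernel (s := control_policy sigma s) zeta.
apply: (integral_eq_concentrated mA AT A1).
  rewrite addr_ge0 ?total_cost_ge0// mulr_ge0 ?disc_exp_ge0//.
  rewrite addr_ge0 ?txpower_ge0// addr_ge0// mulr_ge0 ?value_ge0 ?(hold_ge0 SA)//.
  by have /andP[] := disc_itv SA.
move=> z ->; rewrite nE; etransitivity; first by
  apply: IH; [lia|exact: feasible_rcons].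
rewrite total_cost_rcons /= buffer_rcons -[in LHS]addrA exprSr -mulrA -mulrDr.
by rewrite -[in LHS]addrA.
Qed.

End Policies.

(* The first two conjuncts say that the thresholds b_{n,k}(s) and the
   quantities z_n^*(x, s) are well defined by their case distinctions. *)
Theorem theorem4 (R : realType) (S : finType) (M : model R S) :
  standing_assumptions M ->
  [/\ forall (n k : nat) (s : S), (1 <= n <= horizon M)%N ->
        (k <= nbrk M)%N -> exists! j : nat, critical_index M n k s j,
      forall (n : nat) (x : R) (s : S), (1 <= n <= horizon M)%N ->
        0 <= x -> exists! z : R, zstar_case M n x s z
    & exists2 pi : policy, is_markov_policy M pi (zstar M) & optimal M pi].
Proof.
move=> SA.
have HQ n : (0 < n)%N -> gamma_supports M n (onward M n).
  by case: n => [//|n] _; exact: onward_gamma_supports.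
split.
- move=> n k s /andP[n0 _] kK.
  have [j jP] := critical_index_exists SA n0 s kK.
  by exists j; split => // j'; exact: (critical_index_uniq SA n0 (HQ n n0) kK jP).
- move=> n x s /andP[n0 _] x0; exists (control M n x s); split.
    exact: (control_zstar_case SA n0 (HQ n n0)).
  by move=> z /(zstar_case_control SA n0 (HQ n n0)).
exists (control_policy M).
  move=> t sigma s zeta A tN fz mA; rewrite control_policyE.
  have n0 : (0 < horizon M - t)%N by rewrite subn_gt0.
  by rewrite (zstarE SA n0 (HQ _ n0))// (buffer_ge0 fz).
split; first exact: control_policy_admissible.
move=> pi' api'.
have fz : feasible_history M ([tuple] : 0.-tuple S) ([tuple] : 0.-tuple R) by case.
(* Both expected costs are compared with one number, the cost-to-go from the empty history. *)
rewrite /expected_cost expectation_control//.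
exact: expectation_ge.
Qed.
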